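(* Let $C$ be a bivariate copula, $\phi\in\mathcal{F}_1$, $\psi\in\mathcal{F}_2$, with associated numbers $\alpha,\beta\in[0,1]$ (all defined in the context). Then the limit $\lim_{n\to\infty}T_{\phi,\psi}^{(n)}(C)(u,v)$ exists for every $(u,v)\in[0,1]^2$ and equals: (a) $C(u,v)$ on the SE corner $\{u\ge\alpha,\ v\le 1-\beta\}$; (b) $\dfrac{u}{\alpha}\,C(\alpha,v)$ on the SW corner $\{u\le\alpha,\ v\le1-\beta\}$; (c) $u-\dfrac{1-v}{\beta}\bigl(u-C(u,1-\beta)\bigr)$ on the NE corner $\{u\ge\alpha,\ v\ge1-\beta\}$; (d) on the NW corner $\{u\le\alpha,\ v\ge 1-\beta\}$: either $$u-\frac{u(1-v)}{\alpha\beta}\bigl(\alpha-C(\alpha,1-\beta)\bigr)\prod_{k=0}^{\infty}\left(1-\frac{1-\phi^*(\phi^{(k)}(u))}{\phi^*(\phi^{(k)}(u))}\cdot\frac{\psi_*(\psi^{(k)}(v))}{1-\psi_*(\psi^{(k)}(v))}\right)$$ if $\phi^*(u)>\psi_*(v)$ (in this case the product always converges), or $u$ if $\phi^*(u)\le\psi_*(v)$.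
   Context: $\mathcal{F}_1$ is the class of nondecreasing functions $\phi:[0,1]\to[0,1]$ with $\phi(0)=0$, $\phi(1)=1$ such that $\phi^*(u):=u/\phi(u)$ is nondecreasing on $(0,1]$. $\mathcal{F}_2$ is the class of nondecreasing functions $\psi:[0,1]\to[0,1]$ with $\psi(0)=0$, $\psi(1)=1$ such that the function $\psi_*$ defined by $\psi_*(v)=\frac{v-\psi(v)}{1-\psi(v)}$ for $v\in[0,1)$ and $\psi_*(1)=1$ is nondecreasing. The maxmin transformation on copulas is $$T_{\phi,\psi}(C)(u,v)=u+\bigl(C(\phi(u),\psi(v))-\phi(u)\bigr)\max\{0,\phi^*(u)-\psi_*(v)\},$$ and $T_{\phi,\psi}^{(n)}=T_{\phi,\psi}\circ T_{\phi,\psi}^{(n-1)}$ is its $n$-th iterate. With $\phi^{(k)},\psi^{(k)}$ denoting $k$-fold compositions ($\phi^{(0)}=\psi^{(0)}=\mathrm{id}$), explicitly $$T_{\phi,\psi}^{(n)}(C)(u,v)=u-u(1-v)\frac{\phi^{(n)}(u)-C(\phi^{(n)}(u),\psi^{(n)}(v))}{\phi^{(n)}(u)(1-\psi^{(n)}(v))}\prod_{k=0}^{n-1}\max\left\{0,1-\frac{1-\phi^*(\phi^{(k)}(u))}{\phi^*(\phi^{(k)}(u))}\frac{\psi_*(\psi^{(k)}(v))}{1-\psi_*(\psi^{(k)}(v))}\right\}.$$ All these expressions, and those for the limit, are read as $0$ when $u=0$ and as $u$ when $v=1$. $\alpha$ is the smallest number in $[0,1]$ such that $\phi(x)=x$ for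 all $x\in[\alpha,1]$, and $1-\beta$ is the greatest number in $[0,1]$ such that $\psi(x)=x$ for all $x\in[0,1-\beta]$. Convergence of an infinite product of positive factors means that the partial products converge to a nonzero limit. *)

(* Defs.v *)
From mathcomp Require Import all_boot all_order all_algebra.
From mathcomp Require Import all_classical all_reals all_analysis.

Set Implicit Arguments.
Unset Strict Implicit.
Unset Printing Implicit Defensive.

Import Order.TTheory GRing.Theory Num.Theory.
Import numFieldNormedType.Exports.
Local Open Scope classical_set_scope.
Local Open Scope ring_scope.

(* Functions on [0,1] and on [0,1]^2 are encoded as total functions on R and
   R x R of which only the values on [0,1], resp. [0,1]^2, are constrained or
   used. *)

Record copula (R : realType) (C : R -> R -> R) : Prop := Copula {
  copula_range : forall u v, 0 <= u <= 1 -> 0 <= v <= 1 -> 0 <= C u v <= 1;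
  copula_u0 : forall u, 0 <= u <= 1 -> C u 0 = 0;
  copula_0v : forall v, 0 <= v <= 1 -> C 0 v = 0;
  copula_u1 : forall u, 0 <= u <= 1 -> C u 1 = u;
  copula_1v : forall v, 0 <= v <= 1 -> C 1 v = v;
  copula_2increasing : forall u1 u2 v1 v2,
    0 <= u1 -> u1 <= u2 -> u2 <= 1 -> 0 <= v1 -> v1 <= v2 -> v2 <= 1 ->
    0 <= C u2 v2 - C u2 v1 - C u1 v2 + C u1 v1 }.

(* Meaningful for u in ]0, 1] only; division being total, the value at 0
   is 0, hence never above lower_star psi v. *)
Definition upper_star (R : realType) (phi : R -> R) (u : R) : R := u / phi u.

Definition lower_star (R : realType) (psi : R -> R) (v : R) : R :=
  if v == 1 then 1 else (v - psi v) / (1 - psi v).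

(* The field F1_pos says that the quotient u / phi u is a genuine one; as
   division by 0 yields 0, F1_star alone would not exclude phi u = 0.  The
   field F2_lt1 plays the same role for lower_star. *)
Record F1 (R : realType) (phi : R -> R) : Prop := MkF1 {
  F1_range : forall u, 0 <= u <= 1 -> 0 <= phi u <= 1;
  F1_ndecr : forall u1 u2, 0 <= u1 -> u1 <= u2 -> u2 <= 1 -> phi u1 <= phi u2;
  F1_0 : phi 0 = 0;
  F1_1 : phi 1 = 1;
  F1_pos : forall u, 0 < u <= 1 -> 0 < phi u;
  F1_star : forall u1 u2, 0 < u1 -> u1 <= u2 -> u2 <= 1 ->
    upper_star phi u1 <= upper_star phi u2 }.

Record F2 (R : realType) (psi : R -> R) : Prop := MkF2 {
  F2_range : forall v, 0 <= v <= 1 -> 0 <= psi v <= 1;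
  F2_ndecr : forall v1 v2, 0 <= v1 -> v1 <= v2 -> v2 <= 1 -> psi v1 <= psi v2;
  F2_0 : psi 0 = 0;
  F2_1 : psi 1 = 1;
  F2_lt1 : forall v, 0 <= v < 1 -> psi v < 1;
  F2_star : forall v1 v2, 0 <= v1 -> v1 <= v2 -> v2 <= 1 ->
    lower_star psi v1 <= lower_star psi v2 }.

(* For a copula C, the second factor vanishes when u = 0 or v = 1, so the
   value is 0 when u = 0 (whatever upper_star phi 0 is) and u when v = 1. *)
Definition maxmin (R : realType) (phi psi : R -> R) (C : R -> R -> R)
    (u v : R) : R :=
  u + (C (phi u) (psi v) - phi u)
      * Num.max 0 (upper_star phi u - lower_star psi v).

Definition is_alpha (R : realType) (phi : R -> R) (alpha : R) : Prop :=
  let A := [set a : R | 0 <= a <= 1 /\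
                        forall x, a <= x <= 1 -> phi x = x] in
  A alpha /\ lbound A alpha.

Definition is_beta (R : realType) (psi : R -> R) (beta : R) : Prop :=
  let B := [set b : R | 0 <= b <= 1 /\
                        forall x, 0 <= x <= b -> psi x = x] in
  B (1 - beta) /\ ubound B (1 - beta).

Definition infprod (R : realType) (f : nat -> R) : R :=
  limn (fun n => \prod_(0 <= k < n) f k).

(* Divergence to 0 does not count as convergence. *)
Definition infprod_cvg (R : realType) (f : nat -> R) : Prop :=
  cvgn (fun n => \prod_(0 <= k < n) f k) /\ infprod f <> 0.

Definition nw_factor (R : realType) (phi psi : R -> R) (u v : R) (k : nat) : R :=
  let p := upper_star phi (iter k phi u) in
  let q := lower_star psi (iter k psi v) in
  1 - (1 - p) / p * (q / (1 - q)).

(* Main.v *)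
Require Import Defs.
From mathcomp Require Import all_boot all_order all_algebra.
From mathcomp Require Import all_classical all_reals all_analysis.
From mathcomp Require Import ring lra.

Set Implicit Arguments.
Unset Strict Implicit.
Unset Printing Implicit Defensive.

Import Order.TTheory GRing.Theory Num.Theory.
Import numFieldNormedType.Exports.
Local Open Scope classical_set_scope.
Local Open Scope ring_scope.

(** Write [a_k], [b_k] for the orbits of [u] under [phi] and of [v] under [psi],
    and [p_k], [q_k] for the values of [upper_star phi], [lower_star psi] along
    them.  Unfolding the recursion,
      [T^n C (u, v) = u - (a_n - C (a_n, b_n)) * \prod_(k < n) max (0, p_k - q_k)].
    On the boundary [u = 0] or [v = 1] the subtracted term vanishes.  Elsewhere
    [p_k - q_k = p_k * (1 - q_k) * f_k] with [f_k] the north-west factor, and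
    since [p_k = a_k / a_{k+1}] and [1 - q_k = (1 - b_k) / (1 - b_{k+1})] the
    products of the first two factors telescope ([iter_maxmin_factored]).

    Three limits remain.  The orbit [a_n] increases to [max (u, alpha)], because
    its limit is a fixed point of [phi] and all points above a positive fixed
    point are fixed ([cvg_iter_F1]); the reflection [x |-> 1 - x] gives the same
    for [1 - b_n] and [max (1 - v, beta)] ([cvg_iter_F2]).  A copula is
    Lipschitz, so [C (a_n, b_n)] converges ([cvg_copula]).  Finally the product
    of the [max (0, f_k)] has limit 0 if its first factor vanishes, and is 1
    identically if [u] or [v] is a fixed point.  If [q_0 < p_0], its factors lie
    in [0, 1] and satisfy [p_k ^ N <= f_k] for one fixed [N]
    ([nw_factor_bounds]); hence the partial products decrease while staying
    above [(u / a_n) ^ N >= u ^ N], and the limit is positive.  The four corners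
    are the four ways of evaluating the two maxima. *)

(** * Iterates of a function of the first class *)

Lemma F1_ge (R : realType) (phi : R -> R) (u : R) :
  F1 phi -> 0 < u <= 1 -> u <= phi u.
Proof.
move=> hphi /andP[u0 u1].
have p0 : 0 < phi u by apply: (F1_pos hphi); rewrite u0.
have := F1_star hphi u0 u1 (lexx _).
by rewrite /upper_star (F1_1 hphi) divr1 ler_pdivrMr// mul1r.
Qed.

Lemma upper_star_itv (R : realType) (phi : R -> R) (u : R) :
  F1 phi -> 0 < u <= 1 -> 0 < upper_star phi u <= 1.
Proof.
move=> hphi u01; have p0 := F1_pos hphi u01.
have := F1_ge hphi u01; case/andP: u01 => u0 u1 le_u.
by rewrite /upper_star divr_gt0//= ler_pdivrMr// mul1r.
Qed.

Lemma iter_F1_itv (R : realType) (phi : R -> R) (u : R) n :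
  F1 phi -> 0 < u <= 1 -> u <= iter n phi u <= 1.
Proof.
move=> hphi u01; elim: n => [|n /andP[IH1 IH2]] /=; first by rewrite lexx; lra.
have x01 : 0 < iter n phi u <= 1 by lra.
have := F1_ge hphi x01; have : 0 <= iter n phi u <= 1 by lra.
by move=> /(F1_range hphi); lra.
Qed.

Lemma iter_F1_01 (R : realType) (phi : R -> R) (u : R) n :
  F1 phi -> 0 < u <= 1 -> 0 < iter n phi u <= 1.
Proof. by move=> hphi u01; have := iter_F1_itv n hphi u01; lra. Qed.

Lemma iter_F1_ndecr (R : realType) (phi : R -> R) (u : R) :
  F1 phi -> 0 < u <= 1 ->
  {homo (fun n => iter n phi u) : m n / (m <= n)%N >-> m <= n}.
Proof.
move=> hphi u01; apply/nondecreasing_seqP => n /=.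
exact: F1_ge (iter_F1_01 n hphi u01).
Qed.

Lemma iter_F1_le_fix (R : realType) (phi : R -> R) (a u : R) n :
  F1 phi -> 0 < u <= a -> a <= 1 -> phi a = a -> iter n phi u <= a.
Proof.
move=> hphi ua a1 fixa; elim: n => [|n IH] /=; first by lra.
have u01 : 0 < u <= 1 by lra.
rewrite -[leRHS]fixa; apply: (F1_ndecr hphi) => //.
by have := iter_F1_01 n hphi u01; lra.
Qed.

Lemma iter_F1_fix (R : realType) (phi : R -> R) (u : R) n :
  phi u = u -> iter n phi u = u.
Proof. by move=> fixu; elim: n => //= n ->. Qed.

(** The factors are [x_k / x_{k+1}] along the orbit of [u]: the product
    telescopes. *)
Lemma prod_upper_star (R : realType) (phi : R -> R) (u : R) n :
  F1 phi -> 0 < u <= 1 ->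
  \prod_(0 <= k < n) upper_star phi (iter k phi u) = u / iter n phi u.
Proof.
move=> hphi u01; elim: n => [|n IH].
  by rewrite big_geq//= divff//; case/andP: u01 => /gt_eqF ->.
rewrite big_nat_recr//= IH /upper_star mulrA divfK//.
by have /andP[/gt_eqF -> _] := iter_F1_01 n hphi u01.
Qed.

(** Since [u / phi u] is nondecreasing, [phi y <= phi x * y / x] for
    [x <= y]; hence the limit of an orbit is a fixed point, and by
    monotonicity of [u / phi u] so is everything above it. *)
Lemma cvg_iter_F1 (R : realType) (phi : R -> R) (alpha u : R) :
  F1 phi -> is_alpha phi alpha -> 0 < u <= 1 ->
  (fun n => iter n phi u) @ \oo --> Num.max u alpha.
Proof.
move=> hphi [/= [a01 fix_alpha] min_alpha] u01.
have [leua|ltau] := leP u alpha; last first.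
  have fixu : phi u = u by apply: fix_alpha; lra.
  under eq_fun do rewrite iter_F1_fix//.
  exact: cvg_cst.
have fa : phi alpha = alpha by apply: fix_alpha; lra.
have lea n : iter n phi u <= alpha by apply: iter_F1_le_fix => //; lra.
have x01 n := iter_F1_01 n hphi u01.
have ndx := iter_F1_ndecr hphi u01.
have cvgx : cvgn (fun n => iter n phi u).
  by apply: nondecreasing_is_cvgn => //; exists alpha => _ [n _ <-].
set L := limn (fun n => iter n phi u).
have xL n : iter n phi u <= L by exact: (nondecreasing_cvgn_le ndx cvgx).
have La : L <= alpha by apply: limr_le => //; near=> n.
have L0 : 0 < L by have := xL 0; rewrite /=; lra.
have L01 : 0 < L <= 1 by lra.
have fixL : phi L = L.
  apply/le_anti/andP; split; last exact: F1_ge.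
  (* [x_n * phi L <= phi x_n * L], in the limit. *)
  have cvg1 : (fun n => iter n phi u * phi L) @ \oo --> L * phi L.
    exact: cvgMr_tmp.
  have cvg2 : (fun n => iter n.+1 phi u * L) @ \oo --> L * L.
    by apply: cvgMr_tmp; rewrite (cvg_shiftS (fun n => iter n phi u)).
  rewrite -(ler_pM2l L0); apply: (ler_cvg_to cvg1 cvg2); near=> n.
  have /andP[xn0 xn1] := x01 n.
  have := F1_star hphi xn0 (xL n) (andP L01).2; rewrite /upper_star.
  have p1 := F1_pos hphi (x01 n); have p2 := F1_pos hphi L01.
  by rewrite ler_pdivrMr// mulrAC ler_pdivlMr//= [leRHS]mulrC.
suff -> : alpha = L by [].
apply/le_anti; rewrite La andbT; apply: min_alpha; split; first by lra.
move=> x xL1; have x01' : 0 < x <= 1 by lra.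
apply/le_anti/andP; split; last exact: F1_ge.
have := F1_star hphi L0 (andP xL1).1 (andP xL1).2.
rewrite /upper_star fixL divff ?gt_eqF// ler_pdivlMr ?mul1r//.
exact: F1_pos x01'.
Unshelve. all: by end_near.
Qed.

(** * Reduction of the second class to the first *)

(** Conjugation by the reflection [x |-> 1 - x], which exchanges the two
    classes and turns [beta] into [alpha]. *)
Definition dual (R : realType) (f : R -> R) (x : R) : R := 1 - f (1 - x).

(** Also at [v = 1], where the value 1 prescribed for [lower_star] agrees with
    the convention [0 / 0 = 0]. *)
Lemma lower_starE (R : realType) (psi : R -> R) (v : R) :
  F2 psi -> 0 <= v <= 1 -> lower_star psi v = 1 - upper_star (dual psi) (1 - v).
Proof.
move=> hpsi v01; rewrite /lower_star /upper_star /dual subKr.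
have [->|v1] := eqVneq; first by rewrite subrr mul0r subr0.
have : psi v < 1 by apply: (F2_lt1 hpsi); rewrite lt_neqAle v1; lra.
by move=> p1; field; lra.
Qed.

Lemma F1_dual (R : realType) (psi : R -> R) : F2 psi -> F1 (dual psi).
Proof.
move=> hpsi; rewrite /dual; split.
- by move=> u u01; have : 0 <= 1 - u <= 1 by [lra]; move/(F2_range hpsi); lra.
- move=> x y x0 xy y1; have : psi (1 - y) <= psi (1 - x); last by lra.
  by apply: (F2_ndecr hpsi); lra.
- by rewrite subr0 (F2_1 hpsi) subrr.
- by rewrite subrr (F2_0 hpsi) subr0.
- by move=> u u01; rewrite subr_gt0; apply: (F2_lt1 hpsi); lra.
- move=> x y x0 xy y1.
  have : lower_star psi (1 - y) <= lower_star psi (1 - x).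
    by apply: (F2_star hpsi); lra.
  by rewrite !lower_starE// ?subKr; lra.
Qed.

Lemma is_alpha_dual (R : realType) (psi : R -> R) (beta : R) :
  is_beta psi beta -> is_alpha (dual psi) beta.
Proof.
move=> [/= [b01 fixb] maxb]; split => /=.
  split=> [|x xb]; first by lra.
  by rewrite /dual fixb; lra.
move=> a [a01 fixa]; suff : 1 - a <= 1 - beta by lra.
apply: maxb => /=; split=> [|x xa]; first by lra.
have : dual psi (1 - x) = 1 - x by apply: fixa; lra.
by rewrite /dual subKr; lra.
Qed.

Lemma iter_dual (R : realType) (psi : R -> R) (v : R) n :
  iter n (dual psi) (1 - v) = 1 - iter n psi v.
Proof. by elim: n => //= n ->; rewrite /dual subKr. Qed.

Lemma iter_F2_01 (R : realType) (psi : R -> R) (v : R) n :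
  F2 psi -> 0 <= v < 1 -> 0 <= iter n psi v < 1.
Proof.
move=> hpsi v01; have w01 : 0 < 1 - v <= 1 by lra.
have := iter_F1_01 n (F1_dual hpsi) w01; rewrite iter_dual; lra.
Qed.

Lemma lower_star_itv (R : realType) (psi : R -> R) (v : R) :
  F2 psi -> 0 <= v < 1 -> 0 <= lower_star psi v < 1.
Proof.
move=> hpsi v01; rewrite lower_starE//; last by lra.
have w01 : 0 < 1 - v <= 1 by lra.
by have := upper_star_itv (F1_dual hpsi) w01; lra.
Qed.

Lemma prod_onem_lower_star (R : realType) (psi : R -> R) (v : R) n :
  F2 psi -> 0 <= v < 1 ->
  \prod_(0 <= k < n) (1 - lower_star psi (iter k psi v)) =
  (1 - v) / (1 - iter n psi v).
Proof.
move=> hpsi v01; have w01 : 0 < 1 - v <= 1 by lra.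
have := prod_upper_star n (F1_dual hpsi) w01; rewrite iter_dual => <-.
apply: eq_bigr => k _; have := iter_F2_01 k hpsi v01 => b01.
by rewrite lower_starE ?subKr ?iter_dual//; lra.
Qed.

Lemma cvg_iter_F2 (R : realType) (psi : R -> R) (beta v : R) :
  F2 psi -> is_beta psi beta -> 0 <= v < 1 ->
  (fun n => iter n psi v) @ \oo --> 1 - Num.max (1 - v) beta.
Proof.
move=> hpsi hbeta v01; have w01 : 0 < 1 - v <= 1 by lra.
have := cvg_iter_F1 (F1_dual hpsi) (is_alpha_dual hbeta) w01.
move=> /(cvgB (@cvg_cst _ (1 : R) nat \oo _)).
apply: cvg_trans; apply: near_eq_cvg; near=> n.
by rewrite !fctE iter_dual subKr.
Unshelve. all: by end_near.
Qed.

(** * Continuity of copulas *)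

(** The increments of [C] in one variable are monotone in the other one, so
    they lie between their values on the edges 0 and 1 of the square, where
    [C] is known. *)
Lemma copula_lip (R : realType) (C : R -> R -> R) (u v u' v' : R) : copula C ->
  0 <= u <= 1 -> 0 <= v <= 1 -> 0 <= u' <= 1 -> 0 <= v' <= 1 ->
  `|C u v - C u' v'| <= `|u - u'| + `|v - v'|.
Proof.
move=> hC u01 v01 u01' v01'.
have lip1 x y z : 0 <= x -> x <= y -> y <= 1 -> 0 <= z <= 1 ->
    0 <= C y z - C x z <= y - x.
  move=> x0 xy y1 /andP[z0 z1].
  have h1 := copula_2increasing hC x0 xy y1 (lexx 0) z0 z1.
  have h2 := copula_2increasing hC x0 xy y1 z0 z1 (lexx 1).
  rewrite !(copula_u0 hC) in h1; [|lra..].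
  rewrite !(copula_u1 hC) in h2; lra.
have lip2 x y z : 0 <= x -> x <= y -> y <= 1 -> 0 <= z <= 1 ->
    0 <= C z y - C z x <= y - x.
  move=> x0 xy y1 /andP[z0 z1].
  have h1 := copula_2increasing hC (lexx 0) z0 z1 x0 xy y1.
  have h2 := copula_2increasing hC z0 z1 (lexx 1) x0 xy y1.
  rewrite !(copula_0v hC) in h1; [|lra..].
  rewrite !(copula_1v hC) in h2; lra.
apply: (le_trans (ler_distD (C u' v) _ _)); apply: lerD.
  have := ler_norm (u - u'); have := ler_norm (u' - u).
  rewrite [`|u' - u|]distrC.
  rewrite ler_norml; have [uu|/ltW uu] := leP u u'.
    by have := lip1 u u' v (andP u01).1 uu (andP u01').2 v01; lra.
  by have := lip1 u' u v (andP u01').1 uu (andP u01).2 v01; lra.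
have := ler_norm (v - v'); have := ler_norm (v' - v); rewrite [`|v' - v|]distrC.
rewrite ler_norml; have [vv|/ltW vv] := leP v v'.
  by have := lip2 v v' u' (andP v01).1 vv (andP v01').2 u01'; lra.
by have := lip2 v' v u' (andP v01').1 vv (andP v01).2 u01'; lra.
Qed.

Lemma cvg_copula (R : realType) (C : R -> R -> R) (a b : nat -> R) (x y : R) :
  copula C -> (forall n, 0 <= a n <= 1) -> (forall n, 0 <= b n <= 1) ->
  0 <= x <= 1 -> 0 <= y <= 1 -> a @ \oo --> x -> b @ \oo --> y ->
  (fun n => C (a n) (b n)) @ \oo --> C x y.
Proof.
move=> hC a01 b01 x01 y01 cva cvb; apply/cvgrPdist_le => e e0.
have e20 : 0 < e / 2 by lra.
near=> n.
apply: (le_trans (copula_lip hC x01 y01 (a01 n) (b01 n))).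
rewrite [leRHS](splitr e); apply: lerD; near: n.
  by move/cvgrPdist_le : cva; apply.
by move/cvgrPdist_le : cvb; apply.
Unshelve. all: by end_near.
Qed.

(** * Closed form of the iterates *)

Lemma iter_maxmin (R : realType) (phi psi : R -> R) (C : R -> R -> R) n u v :
  iter n (maxmin phi psi) C u v =
  u - (iter n phi u - C (iter n phi u) (iter n psi v))
      * \prod_(0 <= k < n) Num.max 0
          (upper_star phi (iter k phi u) - lower_star psi (iter k psi v)).
Proof.
elim: n u v => [|n IH] u v; first by rewrite big_geq//= mulr1 subKr.
rewrite iterS /maxmin -/(maxmin _ _) IH big_nat_recl// !iterSr.
under [in RHS]eq_bigr do rewrite !iterSr.
by rewrite /=; ring.
Qed.

Lemma iter_itv (R : realType) (f : R -> R) (x : R) n :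
  (forall y, 0 <= y <= 1 -> 0 <= f y <= 1) -> 0 <= x <= 1 ->
  0 <= iter n f x <= 1.
Proof. by move=> hf x01; elim: n => //= n; exact: hf. Qed.

Lemma iter_maxmin_boundary (R : realType) (phi psi : R -> R) (C : R -> R -> R)
    (u v : R) n : copula C -> F1 phi -> F2 psi ->
  0 <= u <= 1 -> 0 <= v <= 1 -> u = 0 \/ v = 1 ->
  iter n (maxmin phi psi) C u v = u.
Proof.
move=> hC hphi hpsi u01 v01 uv; rewrite iter_maxmin.
have a01 := iter_itv n (F1_range hphi) u01.
have b01 := iter_itv n (F2_range hpsi) v01.
case: uv => [u0|v1].
  rewrite u0 (iter_F1_fix _ (F1_0 hphi)) (copula_0v hC)//; ring.
rewrite v1 (iter_F1_fix _ (F2_1 hpsi)) (copula_u1 hC)//; ring.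
Qed.

Lemma nw_factorE (R : realType) (phi psi : R -> R) (u v : R) k :
  F1 phi -> F2 psi -> 0 < u <= 1 -> 0 <= v < 1 ->
  upper_star phi (iter k phi u) - lower_star psi (iter k psi v) =
  upper_star phi (iter k phi u) * (1 - lower_star psi (iter k psi v))
    * nw_factor phi psi u v k.
Proof.
move=> hphi hpsi u01 v01; rewrite /nw_factor.
have p01 := upper_star_itv hphi (iter_F1_01 k hphi u01).
have q01 := lower_star_itv hpsi (iter_F2_01 k hpsi v01).
by field; lra.
Qed.

(** The truncation passes through the positive factors [p_k] and [1 - q_k],
    whose products telescope. *)
Lemma iter_maxmin_factored (R : realType) (phi psi : R -> R)
    (C : R -> R -> R) (u v : R) n :
  F1 phi -> F2 psi -> 0 < u <= 1 -> 0 <= v < 1 ->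
  iter n (maxmin phi psi) C u v =
  u - (iter n phi u - C (iter n phi u) (iter n psi v))
      * (u / iter n phi u * ((1 - v) / (1 - iter n psi v))
         * \prod_(0 <= k < n) Num.max 0 (nw_factor phi psi u v k)).
Proof.
move=> hphi hpsi u01 v01; rewrite iter_maxmin; congr (_ - _ * _).
rewrite -(prod_upper_star n hphi u01) -(prod_onem_lower_star n hpsi v01).
rewrite -!big_split/=; apply: eq_bigr => k _; rewrite nw_factorE//.
have p01 := upper_star_itv hphi (iter_F1_01 k hphi u01).
have q01 := lower_star_itv hpsi (iter_F2_01 k hpsi v01).
by rewrite -[in LHS](mulr0 (upper_star phi (iter k phi u)
  * (1 - lower_star psi (iter k psi v)))) maxr_pMr//; nra.
Qed.

(** All corners at once: which of the two arguments of [m] and [w] is the larger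
    one tells in which corner [(u, v)] lies. *)
Lemma cvg_iter_maxmin (R : realType) (C : R -> R -> R) (phi psi : R -> R)
    (alpha beta : R) (u v P : R) :
  let m : R := Num.max u alpha in
  let w : R := Num.max (1 - v) beta in
  copula C -> F1 phi -> F2 psi -> is_alpha phi alpha -> is_beta psi beta ->
  0 < u <= 1 -> 0 <= v < 1 ->
  (fun n => \prod_(0 <= k < n) Num.max 0 (nw_factor phi psi u v k)) @ \oo
    --> P ->
  (fun n => iter n (maxmin phi psi) C u v) @ \oo -->
    u - (m - C m (1 - w)) * (u / m * ((1 - v) / w) * P).
Proof.
move=> m w hC hphi hpsi ha hb u01 v01 cvP.
have m01 : 0 < m <= 1.
  by case: ha => -[/= ? _] _; rewrite /m; have [h|h] := leP u alpha; lra.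
have w01 : 0 < w <= 1.
  by case: hb => -[/= ? _] _; rewrite /w; have [h|h] := leP (1 - v) beta; lra.
under eq_fun do rewrite iter_maxmin_factored//.
have cva := cvg_iter_F1 hphi ha u01.
have cvb := cvg_iter_F2 hpsi hb v01.
apply: cvgB; first exact: cvg_cst.
apply: cvgM.
  apply: cvgB; first exact: cva.
  apply: cvg_copula => // [n|n||]; [| |lra|lra].
  - by have := iter_F1_01 n hphi u01; lra.
  - by have := iter_F2_01 n hpsi v01; lra.
apply: cvgM => //; apply: cvgM.
  apply: cvgM; first exact: cvg_cst.
  by apply: cvgV => //; lra.
apply: cvgM; first exact: cvg_cst.
apply: cvgV; first by lra.
rewrite -[w in _ --> w](subKr 1); apply: cvgB => //; exact: cvg_cst.
Qed.

(** * The infinite product *)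

Lemma bernoulli_ineq (R : realDomainType) (t : R) n :
  0 <= t -> 1 + n%:R * t <= (1 + t) ^+ n.
Proof.
move=> t0; elim: n => [|n IH]; first by rewrite expr0; lra.
have n0 : 0 <= n%:R :> R by [].
by rewrite exprS -natr1; nra.
Qed.

(** With [t = 1 / p_k - 1] and [y = q_k / (1 - q_k)] the factor is [1 - t * y],
    and [p_k = 1 / (1 + t)].  Along the orbits [p_k] increases and [q_k]
    decreases, so [1 - t * y >= f_0 > 0]; once [N * f_0 >= y_0], this gives
    [(1 - t * y) * (1 + N * t) >= 1], and Bernoulli's inequality replaces
    [1 + N * t] by [(1 + t) ^ N].  This compares the product with a power of
    the telescoping one. *)
Lemma nw_factor_bounds (R : realType) (phi psi : R -> R) (u v : R) :
  F1 phi -> F2 psi -> 0 < u <= 1 -> 0 <= v < 1 ->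
  lower_star psi v < upper_star phi u ->
  exists N, forall k,
    upper_star phi (iter k phi u) ^+ N <= nw_factor phi psi u v k <= 1.
Proof.
move=> hphi hpsi u01 v01 qp; rewrite /nw_factor.
set p := upper_star phi u in qp *; set q := lower_star psi v in qp *.
have p01 : 0 < p <= 1 by exact: upper_star_itv.
have q01 : 0 <= q < 1 by exact: lower_star_itv.
pose x0 := (1 - p) / p * (q / (1 - q)).
have x01 : x0 < 1.
  rewrite /x0 mulf_div ltr_pdivrMr ?mul1r; nra.
pose y0 := q / (1 - q).
have y00 : 0 <= y0 by rewrite /y0 divr_ge0; lra.
(* [1 - x0] is the factor of index 0. *)
exists (Num.bound (y0 / (1 - x0))) => k.
set N := Num.bound _.
have hN : y0 <= N%:R * (1 - x0).
  rewrite -ler_pdivrMr; last by lra.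
  by apply/ltW/archi_boundP; rewrite divr_ge0//; lra.
set pk := upper_star phi _; set qk := lower_star psi _.
have a01 := iter_F1_itv k hphi u01.
have b01 := iter_F2_01 k hpsi v01.
have pk01 : 0 < pk <= 1 by apply: upper_star_itv => //; lra.
have qk01 : 0 <= qk < 1 by exact: lower_star_itv.
have ppk : p <= pk by apply: (F1_star hphi); lra.
have qkq : qk <= q.
  have w01 : 0 < 1 - v <= 1 by lra.
  have := iter_F1_itv k (F1_dual hpsi) w01; rewrite iter_dual => le_b.
  by apply: (F2_star hpsi); lra.
set t := (1 - pk) / pk; set y := qk / (1 - qk).
have t0 : 0 <= t by rewrite /t divr_ge0; lra.
have tt0 : t <= (1 - p) / p.
  rewrite /t ler_pdivrMr; last by lra.
  by rewrite mulrAC ler_pdivlMr; nra.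
have y_ge0 : 0 <= y by rewrite /y divr_ge0; lra.
have yy0 : y <= y0.
  rewrite /y /y0 ler_pdivrMr; last by lra.
  by rewrite mulrAC ler_pdivlMr; nra.
have xx0 : t * y <= x0 by rewrite /x0 ler_pM.
have ty0 : 0 <= t * y by rewrite mulr_ge0.
apply/andP; split; last by lra.
have -> : pk = (1 + t)^-1 by rewrite /t; field; lra.
rewrite exprVn -div1r ler_pdivrMr; last by rewrite exprn_gt0//; lra.
have bern := bernoulli_ineq N t0.
apply: (@le_trans _ _ ((1 - t * y) * (1 + N%:R * t))); last first.
  by rewrite ler_wpM2l//; lra.
have n0 : 0 <= N%:R :> R by [].
have h1 : y <= N%:R * (1 - t * y).
  apply: (le_trans yy0); apply: (le_trans hN).
  by rewrite ler_wpM2l//; lra.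
have := ler_wpM2l t0 h1; lra.
Qed.

(** The partial products decrease, and stay above [u ^ N] by comparison with the
    [N]-th power of the telescoping product. *)
Lemma infprod_cvg_nw_factor (R : realType) (phi psi : R -> R) (u v : R) :
  F1 phi -> F2 psi -> 0 < u <= 1 -> 0 <= v < 1 ->
  lower_star psi v < upper_star phi u ->
  infprod_cvg (nw_factor phi psi u v).
Proof.
move=> hphi hpsi u01 v01 qp.
have [N hN] := nw_factor_bounds hphi hpsi u01 v01 qp.
have p0 k : 0 < upper_star phi (iter k phi u).
  by have := upper_star_itv hphi (iter_F1_01 k hphi u01); lra.
have f0 k : 0 < nw_factor phi psi u v k.
  by apply: lt_le_trans (andP (hN k)).1; rewrite exprn_gt0.
have lb n : u ^+ N <= \prod_(0 <= k < n) nw_factor phi psi u v k.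
  apply: (@le_trans _ _ ((u / iter n phi u) ^+ N)).
    have a01 := iter_F1_01 n hphi u01.
    by apply: lerXn2r; rewrite ?nnegrE ?divr_ge0 ?ler_pdivlMr//; nra.
  rewrite -(prod_upper_star n hphi u01) -prodrXl ler_prod// => k _.
  by rewrite exprn_ge0 ?(ltW (p0 k))//; have /andP[] := hN k.
have ni : {homo (fun n => \prod_(0 <= k < n) nw_factor phi psi u v k) :
    m n / (m <= n)%N >-> n <= m}.
  apply/nonincreasing_seqP => n; rewrite big_nat_recr//=.
  by rewrite ler_piMr ?(andP (hN n)).2// prodr_ge0// => k _; rewrite ltW.
have cv : cvgn (fun n => \prod_(0 <= k < n) nw_factor phi psi u v k).
  by apply: nonincreasing_is_cvgn => //; exists (u ^+ N) => _ [n _ <-].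
split=> //; apply/eqP; rewrite gt_eqF//.
apply: (@lt_le_trans _ _ (u ^+ N)); first by rewrite exprn_gt0; lra.
by apply: limr_ge => //; near=> n.
Unshelve. all: by end_near.
Qed.

Lemma cvg_prod_nw_pos (R : realType) (phi psi : R -> R) (u v : R) :
  F1 phi -> F2 psi -> 0 < u <= 1 -> 0 <= v < 1 ->
  lower_star psi v < upper_star phi u ->
  (fun n => \prod_(0 <= k < n) Num.max 0 (nw_factor phi psi u v k)) @ \oo
    --> infprod (nw_factor phi psi u v).
Proof.
move=> hphi hpsi u01 v01 qp.
have [cv _] := infprod_cvg_nw_factor hphi hpsi u01 v01 qp.
have [N hN] := nw_factor_bounds hphi hpsi u01 v01 qp.
rewrite [X in X @ \oo](_ : _ =
    (fun n => \prod_(0 <= k < n) nw_factor phi psi u v k)) //.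
apply/funext => n; apply: eq_bigr => k _; apply: max_idPr.
apply: le_trans (andP (hN k)).1; rewrite exprn_ge0//.
by have := upper_star_itv hphi (iter_F1_01 k hphi u01); lra.
Qed.

(** The factor of index 0 is the one truncated to 0. *)
Lemma cvg_prod_nw_zero (R : realType) (phi psi : R -> R) (u v : R) :
  F1 phi -> F2 psi -> 0 < u <= 1 -> 0 <= v < 1 ->
  upper_star phi u <= lower_star psi v ->
  (fun n => \prod_(0 <= k < n) Num.max 0 (nw_factor phi psi u v k)) @ \oo
    --> (0 : R).
Proof.
move=> hphi hpsi u01 v01 pq.
have max0 : Num.max 0 (nw_factor phi psi u v 0) = 0.
  apply: max_idPl.
  have pq0 : 0 < upper_star phi u * (1 - lower_star psi v).
    have := upper_star_itv hphi u01; have := lower_star_itv hpsi v01.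
    by move=> *; rewrite mulr_gt0; lra.
  have /= := nw_factorE 0 hphi hpsi u01 v01.
  by rewrite -(pmulr_rle0 _ pq0) => <-; rewrite subr_le0.
rewrite -cvg_shiftS [X in X @ \oo](_ : _ = fun=> 0); first exact: cvg_cst.
by apply/funext => n; rewrite /= big_nat_recl// max0 mul0r.
Qed.

Lemma cvg_prod_nw_one (R : realType) (phi psi : R -> R) (u v : R) :
  F1 phi -> F2 psi -> 0 < u <= 1 -> 0 <= v < 1 ->
  phi u = u \/ psi v = v ->
  (fun n => \prod_(0 <= k < n) Num.max 0 (nw_factor phi psi u v k)) @ \oo
    --> (1 : R).
Proof.
move=> hphi hpsi u01 v01 fixuv.
have one k : nw_factor phi psi u v k = 1.
  rewrite /nw_factor /upper_star /lower_star.
  case: fixuv => fixx; rewrite (iter_F1_fix _ fixx) fixx.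
    by rewrite divff ?subrr ?mul0r ?subr0//; lra.
  by rewrite lt_eqF ?subrr ?mul0r ?mulr0 ?subr0//; lra.
rewrite [X in X @ \oo](_ : _ = fun=> 1); last first.
  by apply/funext => n; apply: big1 => k _; rewrite one (max_idPr ler01).
exact: cvg_cst.
Qed.

(** * The limit of the iterates *)

Theorem theorem10 (R : realType) (C : R -> R -> R) (phi psi : R -> R)
    (alpha beta : R)
    (hC : copula C) (hphi : F1 phi) (hpsi : F2 psi)
    (halpha : is_alpha phi alpha) (hbeta : is_beta psi beta)
    (u v : R) (hu : 0 <= u <= 1) (hv : 0 <= v <= 1) :
  let Tn := fun n : nat => iter n (maxmin phi psi) C u v in
  [/\ cvgn Tn,
      alpha <= u -> v <= 1 - beta ->
        Tn @ \oo --> C u v,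
      u <= alpha -> v <= 1 - beta ->
        Tn @ \oo --> u / alpha * C alpha v,
      alpha <= u -> 1 - beta <= v ->
        Tn @ \oo --> u - (1 - v) / beta * (u - C u (1 - beta)) &
      u <= alpha -> 1 - beta <= v ->
        (lower_star psi v < upper_star phi u ->
           infprod_cvg (nw_factor phi psi u v) /\
           Tn @ \oo --> u - u * (1 - v) / (alpha * beta)
                            * (alpha - C alpha (1 - beta))
                            * infprod (nw_factor phi psi u v)) /\
        (upper_star phi u <= lower_star psi v ->
           Tn @ \oo --> u)].
Proof.
move=> Tn.
have [a01 fixa] := halpha.1; have [b01 fixb] := hbeta.1.
rewrite /= in a01 fixa b01 fixb.
have [uv|/not_orP[/eqP u0 /eqP v1]] := pselect (u = 0 \/ v = 1).
  have TnE : Tn = fun=> u.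
    by apply/funext => n; exact: iter_maxmin_boundary.
  have cvu : Tn @ \oo --> u by rewrite TnE; exact: cvg_cst.
  (* The infinite product is never called for on the boundary: if [u = 0] then
     [upper_star phi u = 0], and if [v = 1] then [lower_star psi v = 1]. *)
  have q_ge0 : 0 <= lower_star psi v.
    have := F2_star hpsi (lexx 0) (andP hv).1 (andP hv).2.
    by rewrite {1}/lower_star eq_sym oner_eq0 (F2_0 hpsi) subrr mul0r.
  split.
  - by apply: cvgP cvu.
  - move=> _ _; suff -> : C u v = u by [].
    by case: uv => ->; [exact: copula_0v|exact: copula_u1].
  - move=> ua _; suff -> : u / alpha * C alpha v = u by [].
    case: uv => ->; first by rewrite !mul0r.
    rewrite (copula_u1 hC)//; have [alpha0|alpha0] := eqVneq alpha 0.
      by rewrite alpha0 mulr0; lra.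
    by rewrite divfK.
  - move=> _ _; suff -> : u - (1 - v) / beta * (u - C u (1 - beta)) = u by [].
    case: uv => ->; last by rewrite subrr !mul0r subr0.
    by rewrite (copula_0v hC) ?subrr ?mulr0 ?subr0//; lra.
  - move=> _ _; split=> // qp; exfalso; case: uv => e.
      by move: qp; rewrite {1}e /upper_star mul0r; lra.
    move: qp; rewrite {1}e /lower_star eqxx; have [eu|nu] := eqVneq u 0.
      by rewrite eu /upper_star mul0r; lra.
    have u01 : 0 < u <= 1 by rewrite lt_neqAle eq_sym nu.
    by have := upper_star_itv hphi u01; lra.
have u01 : 0 < u <= 1 by rewrite lt_neqAle eq_sym u0.
have v01 : 0 <= v < 1 by rewrite (lt_neqAle v) v1.
have cvT P := cvg_iter_maxmin (P := P) hC hphi hpsi halpha hbeta u01 v01.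
split.
- have [qp|pq] := ltP (lower_star psi v) (upper_star phi u).
    exact: cvgP (cvT _ (cvg_prod_nw_pos hphi hpsi u01 v01 qp)).
  exact: cvgP (cvT _ (cvg_prod_nw_zero hphi hpsi u01 v01 pq)).
- move=> au vb; have fu : phi u = u by apply: fixa; lra.
  have := cvT _ (cvg_prod_nw_one hphi hpsi u01 v01 (or_introl fu)).
  have -> : Num.max u alpha = u by exact: max_l.
  have -> : Num.max (1 - v) beta = 1 - v by apply: max_l; lra.
  by rewrite subKr !divff ?mulr1 ?subKr//; lra.
- move=> ua vb; have fv : psi v = v by apply: fixb; lra.
  have := cvT _ (cvg_prod_nw_one hphi hpsi u01 v01 (or_intror fv)).
  have -> : Num.max u alpha = alpha by exact: max_r.
  have -> : Num.max (1 - v) beta = 1 - v by apply: max_l; lra.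
  rewrite subKr; congr (_ --> _); field; lra.
- move=> au vb; have fu : phi u = u by apply: fixa; lra.
  have := cvT _ (cvg_prod_nw_one hphi hpsi u01 v01 (or_introl fu)).
  have -> : Num.max u alpha = u by exact: max_l.
  have -> : Num.max (1 - v) beta = beta by apply: max_r; lra.
  congr (_ --> _); field; lra.
- move=> ua vb.
  have ma : Num.max u alpha = alpha by exact: max_r.
  have mb : Num.max (1 - v) beta = beta by apply: max_r; lra.
  rewrite ma mb in cvT; split=> [qp|pq].
    split; first exact: infprod_cvg_nw_factor.
    have := cvT _ (cvg_prod_nw_pos hphi hpsi u01 v01 qp).
    congr (_ --> _); field; lra.
  have := cvT _ (cvg_prod_nw_zero hphi hpsi u01 v01 pq).
  by rewrite !mulr0 subr0.
Qed.
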